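(* There is no $48\times 13$ binary $5$-covering array.
   Context: A binary $t$-covering array of size $m$ and degree $n$ is an $m\times n$ matrix with entries in $\{0,1\}$ such that for any $t$ distinct columns, all $2^t$ binary vectors of length $t$ occur at least once as the restriction of some row to those columns. *)

(* Defs.v *)
From HB Require Import structures.
From mathcomp Require Import all_boot all_order all_algebra.

Set Implicit Arguments.
Unset Strict Implicit.
Unset Printing Implicit Defensive.

(* [c] lists [t] distinct column indices (two of these columns may still have
   the same entries). Since [v] ranges over all vectors, the order in which
   [c] lists the columns is irrelevant. *)
Definition covering_array (t m n : nat) (A : 'M[bool]_(m, n)) : Prop :=
  forall c : 'I_t -> 'I_n, injective c ->
  forall v : 'rV[bool]_t, exists i : 'I_m, row i (colsub c A) = v.

(* Main.v *)
Require Import Defs.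
From HB Require Import structures.
From mathcomp Require Import all_boot all_order all_algebra.
From mathcomp Require Import zify.

(** Fix three columns and values for them.  On the rows with these values the
    other ten columns are pairwise qualitatively independent.  If some column
    took one of its values on at most two of these rows, then normalising the
    nine remaining columns on these two rows would make them an antichain on the
    rows where the column takes its other value; by Sperner's theorem there are
    then at least five such rows.  So there are always at least six rows, with
    equality only if every column splits them evenly.  As 48 = 8 * 6, equality
    does hold: every pattern on four columns occurs exactly three times and the
    array is an orthogonal array of strength 4.  The 78 products of two distinct
    columns (in +1/-1 form) are then orthogonal vectors of squared norm 48 in
    dimension 48, against Bessel's inequality. *)

Set Implicit Arguments.
Unset Strict Implicit.
Unset Printing Implicit Defensive.

Import Order.TTheory GRing.Theory Num.Theory.

(** * Sperner's theorem on four points *)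

(* The number of a chain in a symmetric chain decomposition of the Boolean lattice. *)
Definition chain4 (p q r s : bool) : 'I_6 :=
  match p, q, r, s with
  | false, true, false, true => inord 4
  | true, false, true, false => inord 5
  | false, true, _, _ => inord 1
  | false, false, true, _ | true, false, true, true => inord 2
  | false, false, false, true | true, _, false, true => inord 3
  | _, _, _, _ => inord 0
  end.

Lemma chain4_comparable p q r s p' q' r' s' :
  chain4 p q r s = chain4 p' q' r' s' ->
  [&& p ==> p', q ==> q', r ==> r' & s ==> s'] \/
  [&& p' ==> p, q' ==> q, r' ==> r & s' ==> s].
Proof.
move=> /(congr1 val).
case: p q r s p' q' r' s' => [] [] [] [] [] [] [] [];
  rewrite /= ?inordK //; by [left | right].
Qed.

(** Pigeonhole: six chains cover the Boolean lattice on four points, so two of the seven or more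
    indices fall into the same chain. *)
Lemma sperner4 (C T : finType) (f : C -> T -> bool) (E : {set C}) (Q : {set T}) :
  #|Q| <= 4 -> 6 < #|E| ->
  exists e e', [/\ e \in E, e' \in E, e != e' & {in Q, forall i, f e i ==> f e' i}].
Proof.
move=> Q4 E6.
have [/set0Pn[x0 _]|] := boolP (Q != set0); last first.
  rewrite negbK => /eqP ->.
  have /card_gt1P[e [e' [eE e'E ne]]] : 1 < #|E| by apply: leq_trans E6.
  by exists e, e'; split=> // i; rewrite inE.
(* If [Q] has fewer than four points, the list is padded with [x0]; the extra coordinates do no
   harm, since only those indexing points of [Q] are read back. *)
pose q k := nth x0 (enum Q) k.
pose g e := chain4 (f e (q 0)) (f e (q 1)) (f e (q 2)) (f e (q 3)).
have : ~~ dinjectiveb g (mem E).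
  apply: contraL E6 => /dinjectiveP g_inj; rewrite -leqNgt.
  by rewrite -(card_in_imset g_inj) -[leqRHS]card_ord max_card.
case/dinjectivePn => e eE [e']; rewrite !inE => /andP[ne e'E] /chain4_comparable.
have inQ (P : T -> bool) : [&& P (q 0), P (q 1), P (q 2) & P (q 3)] ->
    {in Q, forall i, P i}.
  move=> /and4P[P0 P1 P2 P3] i; rewrite -mem_enum => /(nthP x0)[k].
  rewrite -cardE => /leq_trans/(_ Q4) + <-.
  by case: k => [|[|[|[|]]]].
case=> /(inQ (fun i => f _ i ==> f _ i)) le.
- by exists e, e'; rewrite eq_sym.
- by exists e', e.
Qed.

Lemma small_side (C T : finType) (X : C -> T -> bool) (E : {set C}) (R S : {set T}) :
  6 < #|E| ->
  {in E, forall e u, exists2 i, i \in R & X e i = u} ->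
  {in E &, forall e e', e != e' -> forall u u',
     exists2 i, i \in R :|: S & X e i = u /\ X e' i = u'} ->
  #|R| <= 2 -> #|R| = 2 /\ 5 <= #|S|.
Proof.
move=> E6 cov1 cov2 R2.
have /card_gt0P[e0 e0E] : 0 < #|E| by apply: leq_trans E6.
have [x xR Xx] := cov1 _ e0E false; have [y yR Xy] := cov1 _ e0E true.
have nxy : x != y by apply: contra_eq_neq Xy => <-; rewrite Xx.
have RE : R = [set x; y].
  by apply/esym/eqP; rewrite eqEcard subUset !sub1set xR yR cards2 nxy.
split; first by rewrite RE cards2 nxy.
have yx e : e \in E -> X e y = ~~ X e x.
  move=> eE; have [i] := cov1 _ eE (~~ X e x).
  by rewrite RE !inE => /orP[]/eqP -> // /esym/eqP; case: (X e x).
rewrite ltnNge; apply/negP => S4.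
have [e [e' [eE e'E ne le]]] := sperner4 (fun e i => X e i (+) X e x) S4 E6.
(* In normalised form this asks for a row with value 1 for [e] and 0 for [e']. Row [x] shows 0 and
   0, row [y] shows 1 and 1, and [le] excludes the rows of [S]. *)
have [i + [Xi Xi']] := cov2 _ _ eE e'E ne (~~ X e x) (X e' x).
rewrite RE !inE -orbA => /or3P[/eqP ix|/eqP iy|/le].
- by move: Xi; rewrite ix; case: (X e x).
- by move: Xi'; rewrite iy yx //; case: (X e' x).
- by rewrite Xi Xi' addbb; case: (X e x).
Qed.

Lemma card_ltn_pairs n : #|[set p : 'I_n * 'I_n | p.1 < p.2]| = 'C(n, 2).
Proof.
rewrite -sum1dep_card -(pair_big_dep xpredT (fun i j : 'I_n => i < j) (fun _ _ => 1)) /=.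
rewrite (exchange_big_dep xpredT) //= -bin2_sum big_mkord; apply: eq_bigr => j _.
by rewrite -(big_ord_widen n (fun _ => 1) (ltnW (ltn_ord j))) sum1_card card_ord.
Qed.

(** * Counting rows of the array *)

Section CoveringArray.

Variable A : 'M[bool]_(48, 13).
Hypothesis covA : covering_array 5 A.

Implicit Types (a b c d e : 'I_13) (u : bool * bool * bool).

Lemma covering_rows (s : seq 'I_13) (v : seq bool) :
  uniq s -> size s = 5 -> exists i, forall k, k < 5 -> A i (nth ord0 s k) = nth false v k.
Proof.
move=> s_uniq s5.
pose f (k : 'I_5) := nth ord0 s k.
have f_inj : injective f.
  by move=> k l /eqP; rewrite nth_uniq ?s5 // => /eqP/val_inj.
have [i /rowP iP] := covA f_inj (\row_k nth false v k)%R.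
by exists i => k k5; have := iP (Ordinal k5); rewrite !mxE.
Qed.

Definition prefix_rows a b c u : {set 'I_48} :=
  [set i | (A i a, A i b, A i c) == u].

Definition pattern_rows a b c d u (w : bool) : {set 'I_48} :=
  [set i in prefix_rows a b c u | A i d == w].

Lemma card_pattern_rowsD a b c d u w :
  #|prefix_rows a b c u| = #|pattern_rows a b c d u w| + #|pattern_rows a b c d u (~~ w)|.
Proof.
rewrite -(cardsID [set i | A i d == w] (prefix_rows a b c u)).
by congr (_ + _); apply: eq_card => i; rewrite !inE; case: (A i d) w => [] [];
  rewrite ?andbT ?andbF.
Qed.

Lemma card_pattern_rows_small a b c d u w : uniq [:: a; b; c; d] ->
  #|pattern_rows a b c d u w| <= 2 ->
  #|pattern_rows a b c d u w| = 2 /\ 5 <= #|pattern_rows a b c d u (~~ w)|.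
Proof.
case: u => [[u1 u2] u3] abcd.
pose E := [set e | e \notin [:: a; b; c; d]].
apply: (small_side (X := fun e i => A i e) (E := E)).
- have -> : E = ~: [set e in [:: a; b; c; d]] by apply/setP => e; rewrite !inE.
  by rewrite cardsCs setCK cardsE (card_uniqP abcd) card_ord.
- move=> e; rewrite inE => eE u.
  have [||i iP] := @covering_rows [:: e; a; b; c; d] [:: u; u1; u2; u3; w] => //.
    by rewrite cons_uniq eE.
  exists i; last exact: (iP 0).
  by rewrite !inE; move: (iP 1) (iP 2) (iP 3) (iP 4) => /= -> // -> // -> // -> //; rewrite !eqxx.
(* The fifth covered column is now [e'] instead of [d], so the row found may lie on either side of
   the split by [d]. *)
- move=> e e'; rewrite !inE => eE e'E ne u u'.
  have [||i iP] := @covering_rows [:: e; e'; a; b; c] [:: u; u'; u1; u2; u3] => //.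
    move: abcd eE e'E; rewrite /= !inE !negb_or => /and4P[] /and3P[-> -> _] /andP[-> _] _ _.
    by move=> /and4P[-> -> -> _] /and4P[-> -> -> _]; rewrite ne.
  exists i; last by split; [exact: (iP 0) | exact: (iP 1)].
  rewrite !inE; move: (iP 2) (iP 3) (iP 4) => /= -> // -> // -> //.
  by rewrite eqxx /=; case: (A i d) w => [] [].
Qed.

Lemma card_prefix_rows_ge a b c d u : uniq [:: a; b; c; d] ->
  6 <= #|prefix_rows a b c u|.
Proof.
move=> abcd; have lo w := @card_pattern_rows_small a b c d u w abcd.
rewrite (card_pattern_rowsD a b c d u true).
(* Either both sides have at least 3 rows, or one has 2 and the other at least 5. *)
by have /= := lo true; have /= := lo false; lia.
Qed.

Lemma card_prefix_rows a b c d u : uniq [:: a; b; c; d] ->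
  #|prefix_rows a b c u| = 6.
Proof.
move=> abcd.
have sum48 : \sum_u #|prefix_rows a b c u| = 48.
  rewrite -[RHS]card_ord -sum1_card.
  rewrite (partition_big (fun i => (A i a, A i b, A i c)) predT) //=.
  by apply: eq_bigr => v _; rewrite -sum1_card; apply: eq_bigl => i; rewrite !inE.
have [_] := leqif_sum (fun v (_ : true) => leqif_eq (@card_prefix_rows_ge a b c d v abcd)).
rewrite sum48 sum_nat_const !card_prod card_bool eqxx => /esym/forallP/(_ u).
by move=> /eqP.
Qed.

Lemma card_pattern_rows a b c d u w : uniq [:: a; b; c; d] ->
  #|pattern_rows a b c d u w| = 3.
Proof.
move=> abcd; have lo w := @card_pattern_rows_small a b c d u w abcd.
have := card_prefix_rows u abcd; rewrite (card_pattern_rowsD a b c d u w).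
(* A side with 2 rows would force a total of at least 7, so both have at least 3. *)
by have := lo w; have := lo (~~ w); rewrite negbK; lia.
Qed.

(** * Orthogonality of the column products *)

Local Open Scope ring_scope.

Lemma sum_pattern (V : zmodType) (g : bool * bool * bool * bool -> V) a b c d :
  uniq [:: a; b; c; d] ->
  \sum_i g (A i a, A i b, A i c, A i d) = (\sum_p g p) *+ 3.
Proof.
move=> abcd.
rewrite (partition_big (fun i => (A i a, A i b, A i c, A i d)) predT) //= -sumrMnl.
apply: eq_bigr => -[u w] _.
rewrite -[RHS](congr1 (GRing.natmul _) (card_pattern_rows u w abcd)) -sumr_const.
apply: eq_big => [i|i /eqP -> //].
by rewrite !inE xpair_eqE.
Qed.

Definition chi (i : 'I_48) a : int := (-1) ^+ A i a.

Lemma chi_sqr i a : chi i a * chi i a = 1.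
Proof. by rewrite /chi -expr2 sqrr_sign. Qed.

(** All patterns occur equally often, and flipping the first entry permutes them while negating the
    summand; hence the sum is its own negative. *)
Lemma sum_chi_free (h : bool -> bool -> bool -> int) a b c d :
  uniq [:: a; b; c; d] -> \sum_i chi i a * h (A i b) (A i c) (A i d) = 0.
Proof.
move=> abcd.
pose g (p : bool * bool * bool * bool) : int :=
  let: (x, y, z, w) := p in (-1) ^+ x * h y z w.
pose flip (p : bool * bool * bool * bool) := let: (x, y, z, w) := p in (~~ x, y, z, w).
have flipK : involutive flip by move=> [[[[] y] z] w].
rewrite (sum_pattern g abcd).
suff /eqP : - \sum_p g p = \sum_p g p by rewrite eqNr => /eqP ->; rewrite mul0rn.
rewrite [RHS](reindex_inj (inv_inj flipK)) -sumrN; apply: eq_bigr => -[[[x y] z] w] _.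
by rewrite /g /= signrN mulNr.
Qed.

Lemma fresh_column (s : seq 'I_13) : (size s < 13)%N -> exists a, a \notin s.
Proof.
move=> s13; apply/existsP; rewrite -negb_forall; apply: contraL s13 => /forallP s_all.
rewrite -leqNgt -[leqLHS]card_ord; apply: leq_trans (card_size s).
by apply/subset_leq_card/subsetP => a _.
Qed.

Lemma sum_chi2 a b : a != b -> \sum_i chi i a * chi i b = 0.
Proof.
(* Two spare columns complete [a] and [b] to the four that strength 4 speaks of. *)
move=> ab; have [c cN] := fresh_column (s := [:: a; b]) isT.
have [d dN] := fresh_column (s := [:: c; a; b]) isT.
have := @sum_chi_free (fun x _ _ => (-1) ^+ x) a b c d; apply.
by move: ab cN dN; rewrite /= !inE !negb_or ![c == _]eq_sym ![d == _]eq_sym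
  => -> /andP[-> ->] /and3P[-> -> ->].
Qed.

Lemma sum_chi4 a b c d : uniq [:: a; b; c; d] ->
  \sum_i (chi i a * chi i b) * (chi i c * chi i d) = 0.
Proof.
move=> /(sum_chi_free (fun x y z => (-1) ^+ x * ((-1) ^+ y * (-1) ^+ z))) sum0.
by rewrite -[RHS]sum0; apply: eq_bigr => i _; rewrite -mulrA.
Qed.

Definition chi_pair (p : 'I_13 * 'I_13) i : int := chi i p.1 * chi i p.2.

(** A shared column squares to 1 and leaves a product of two distinct columns; disjoint pairs give a
    product of four. *)
Lemma sum_chi_pair : {in [set p : 'I_13 * 'I_13 | (p.1 < p.2)%N] &, forall p q, p != q ->
  \sum_i chi_pair p i * chi_pair q i = 0}.
Proof.
move=> [a b] [c d]; rewrite !inE /chi_pair /= => ab cd.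
have common x y z : x != y -> \sum_i (chi i x * chi i z) * (chi i y * chi i z) = 0.
  move=> xy; rewrite -[RHS](sum_chi2 xy); apply: eq_bigr => i _.
  by rewrite mulrACA chi_sqr mulr1.
have [<-|ac] := eqVneq a c.
  have [<-|bd _] := eqVneq b d; first by rewrite eqxx.
  rewrite -[RHS](common b d a bd).
  by apply: eq_bigr => i _; rewrite ![chi i a * _]mulrC.
have [<- _|bd _] := eqVneq b d; first exact: common.
have [ad|ad] := eqVneq a d.
  rewrite -ad -[RHS](common b c a); first by apply: eq_bigr => i _; rewrite [chi i a * _]mulrC.
  (* Here [c < d = a < b]. *)
  by rewrite neq_ltn orbC (ltn_trans cd) // -ad.
have [bc|bc] := eqVneq b c.
  rewrite -bc -[RHS](common a d b) //; by apply: eq_bigr => i _; rewrite [chi i b * chi i d]mulrC.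
apply: sum_chi4.
by rewrite /= !inE !negb_or ac ad bc bd !neq_ltn ab cd.
Qed.

End CoveringArray.

(* Bessel's inequality at the vector dual to row [i0]. *)
Lemma leq_card_orthogonal_signs (I J : finType) (D : {set J}) (f : J -> I -> int) (i0 : I) :
  (forall j i, (f j i * f j i = 1)%R) ->
  {in D &, forall j k, j != k -> (\sum_i f j i * f k i = 0)%R} ->
  #|D| <= #|I|.
Proof.
move=> sqr orth.
(* Up to the factor [#|I|], this is the projection of the unit vector at [i0] onto the span of the
   [f j]. *)
pose s i := (\sum_(j in D) f j i * f j i0)%R.
have s0 : s i0 = #|D|%:R%R.
  by rewrite -sumr_const; apply: eq_bigr => j _; exact: sqr.
have sum_s : (\sum_i s i * s i = #|D|%:R * #|I|%:R :> int)%R.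
  under eq_bigr do rewrite big_distrlr.
  rewrite exchange_big mulr_natl -sumr_const; apply: eq_bigr => j jD.
  rewrite exchange_big (bigD1 j) //= [X in (_ + X)%R]big1 => [|k /andP[kD kj]].
    by rewrite addr0 -sumr_const; apply: eq_bigr => i _; rewrite mulrACA !sqr.
  under eq_bigr do rewrite mulrACA.
  by rewrite -mulr_suml orth ?mul0r // eq_sym.
(* Keeping only the term at [i0] gives [#|D|^2 <= #|D| * #|I|]. *)
have : (s i0 * s i0 <= \sum_i s i * s i)%R.
  by rewrite (bigD1 i0) //= lerDl sumr_ge0 // => i _; rewrite -expr2 sqr_ge0.
by rewrite sum_s s0 -!natrM ler_nat; case: #|D| => // m; rewrite leq_pmul2l.
Qed.

Theorem theorem5p9 : ~ exists A : 'M[bool]_(48, 13), covering_array 5 A.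
Proof.
move=> [A covA].
suff : 'C(13, 2) <= 48 by [].
rewrite -card_ltn_pairs -[leqRHS]card_ord.
apply: leq_card_orthogonal_signs ord0 _ (sum_chi_pair covA) => p i.
by rewrite /chi_pair mulrACA !chi_sqr.
Qed.
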